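(* Let $n\ge1$, $p\in(1,2)$, $k_3>0$, and let $k_1,k_2>0$ be such that $\mathcal{A}^*=\begin{bmatrix}-k_1&1\\-k_2&0\end{bmatrix}$ is Hurwitz. Let $\phi_1,\phi_2:\mathbb{R}^n\to\mathbb{R}^n$ be $$\phi_1(e_1)=k_3e_1+(e_1^{T}e_1)^{\frac{1-p}{3p-2}}e_1,$$ $$\phi_2(e_1)=k_3^2e_1+\frac{2k_3(2p-1)}{3p-2}(e_1^{T}e_1)^{\frac{1-p}{3p-2}}e_1+\frac{p}{3p-2}(e_1^{T}e_1)^{\frac{2(1-p)}{3p-2}}e_1 .$$ Let $\mathcal{Q}^*\in\mathbb{R}^{2\times2}$ be symmetric positive definite, let $\mathcal{P}^*\succ0$ be the unique solution of $(\mathcal{A}^* )^T\mathcal{P}^*+\mathcal{P}^*\mathcal{A}^*=-\mathcal{Q}^*$, let $\mathcal{P}=\mathcal{P}^*\otimes I_n$, $\mathcal{Q}=\mathcal{Q}^*\otimes I_n$ (Kronecker products with the $n\times n$ identity), and set $$\gamma_1=k_3\frac{\lambda_{\min}\{\mathcal{Q}\}}{\lambda_{\max}\{\mathcal{P}\}} .$$ Consider the perturbed system $$\dot e_1=-k_1\phi_1(e_1)+e_2+\delta_1,\qquad \dot e_2=-k_2\phi_2(e_1)+\delta_2,$$ where the (possibly time-varying) perturbation $\delta=(\delta_1^T,\delta_2^T)^T$, $\delta_1,\delta_2\in\mathbb{R}^n$, is bounded as $\|\delta\|\le\bar\delta$. If $$\gamma_1\ge\frac{\lambda_{\max}\{\mathcal{P}\}}{\lambda_{\min}\{\mathcal{P}\}},$$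 then this perturbed system is practically finite-time stable at the origin.
   Context: $\lambda_{\min}\{\cdot\}$ and $\lambda_{\max}\{\cdot\}$ denote the minimum and maximum eigenvalue of a matrix. At $e_1=0$, $\phi_1(0)=\phi_2(0)=0$ (continuous extension). Solutions are absolutely continuous functions satisfying the differential equation almost everywhere. Practical finite-time stability (PFTS) at the origin: there is a bounded neighborhood of the origin, depending only on the system parameters and the bound on the perturbation (not on the initial condition), such that every solution enters this neighborhood in finite time and remains in it thereafter. (In the paper this is the property implied by a Lyapunov inequality $\dot V\le-\lambda_1V-\lambda_2V^\alpha+\eta$ with $\lambda_1,\lambda_2>0$, $\alpha\in(0,1)$, the neighborhood being $\{V\le\min\{\frac{\eta}{(1-\theta_0)\lambda_1},(\frac{\eta}{(1-\theta_0)\lambda_2})^{1/\alpha}\}\}$ with $0<\theta_0<1$.) *)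

(* Defs.v *)
From HB Require Import structures.
From mathcomp Require Import all_boot all_order all_algebra.
From mathcomp Require Import mxtens complex.
From mathcomp Require Import all_classical all_reals all_analysis.

Set Implicit Arguments.
Unset Strict Implicit.
Unset Printing Implicit Defensive.

Import Order.TTheory GRing.Theory Num.Theory.
Import numFieldNormedType.Exports.

Local Open Scope classical_set_scope.
Local Open Scope ring_scope.

Section LinearAlgebra.
Variable R : realType.

Definition posdefmx (m : nat) (A : 'M[R]_m) : Prop :=
  A^T = A /\ forall x : 'cV[R]_m, x != 0 -> 0 < (x^T *m A *m x) 0 0.

(* For a nonempty finite spectrum, such as that of a real symmetric matrix of
   positive size, [inf] and [sup] are the minimum and the maximum. *)
Definition lambda_min (m : nat) (A : 'M[R]_m) : R := inf [set a | eigenvalue A a].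
Definition lambda_max (m : nat) (A : 'M[R]_m) : R := sup [set a | eigenvalue A a].

Definition hurwitz (m : nat) (A : 'M[R]_m) : Prop :=
  forall z : R[i], eigenvalue (map_mx (real_complex R) A) z -> complex.Re z < 0.

Definition sqnorm2 (m : nat) (x : 'cV[R]_m) : R := (x^T *m x) 0 0.

(* The Euclidean norm; the library's [`|x|] on matrices is the max norm. *)
Definition norm2 (m : nat) (x : 'cV[R]_m) : R := Num.sqrt (sqnorm2 x).

End LinearAlgebra.

Section Solutions.
Variables (R : realType) (V : normedModType R).

Definition abs_continuous_on (a b : R) (x : R -> V) : Prop :=
  forall eps : R, 0 < eps -> exists2 del : R, 0 < del &
    forall (m : nat) (u v : 'I_m -> R),
      (forall i, a <= u i /\ u i <= v i /\ v i <= b) ->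
      trivIset setT (fun i => `]u i, v i[%classic) ->
      \sum_(i < m) (v i - u i) < del ->
      \sum_(i < m) `|x (v i) - x (u i)| < eps.

(* Solutions of x' = f t x on [t0, t1[, with t1 finite or +oo. Absolute
   continuity is required on the compact subintervals. *)
Definition is_solution (f : R -> V -> V) (t0 : R) (t1 : \bar R) (x : R -> V) :
    Prop :=
  (forall b : R, t0 <= b -> (b%:E < t1)%E -> abs_continuous_on t0 b x) /\
  {ae (@lebesgue_measure R), forall t : R, t0 <= t -> (t%:E < t1)%E ->
     is_derive t (1 : R) x (f t (x t))}.

(* The system is x' = f d t x, where d ranges over the set D of admissible
   perturbations. The neighborhood N is chosen before the perturbation, the
   initial time and the solution. The first clause says that a solution that has
   entered N stays in N, the second one that solutions defined for all future
   times enter N; the third one excludes finite escape times, so that looking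
   only at [t0, +oo[ in the second clause is no restriction. *)
Definition practically_finite_time_stable (I : Type) (D : set I)
    (f : I -> R -> V -> V) : Prop :=
  exists N : set V, [/\ nbhs (0 : V) N, bounded_set N &
    forall (d : I) (t0 : R) (t1 : \bar R) (x : R -> V),
      D d -> (t0%:E < t1)%E -> is_solution (f d) t0 t1 x ->
      [/\ forall s t : R, t0 <= s -> s <= t -> (t%:E < t1)%E ->
            N (x s) -> N (x t),
          t1 = +oo%E -> exists2 T : R, t0 <= T & N (x T) &
          (t1 < +oo)%E ->
            bounded_set [set x t | t in [set t : R | t0 <= t /\ (t%:E < t1)%E]]]].

End Solutions.

Section System.
Variables (R : realType) (n : nat).

Definition Astar (k1 k2 : R) : 'M[R]_2 :=
  block_mx (- k1)%:M 1%:M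
           (- k2)%:M 0 :> 'M[R]_(1 + 1).

(* [0 `^ s = 0] for [s != 0], so phi1 and phi2 vanish at 0. *)
Definition phi1 (p k3 : R) (e1 : 'cV[R]_n) : 'cV[R]_n :=
  k3 *: e1 + (sqnorm2 e1 `^ ((1 - p) / (3 * p - 2))) *: e1.

Definition phi2 (p k3 : R) (e1 : 'cV[R]_n) : 'cV[R]_n :=
  k3 ^+ 2 *: e1
  + (2 * k3 * (2 * p - 1) / (3 * p - 2)
       * sqnorm2 e1 `^ ((1 - p) / (3 * p - 2))) *: e1
  + (p / (3 * p - 2)
       * sqnorm2 e1 `^ (2 * (1 - p) / (3 * p - 2))) *: e1.

Definition gamma1 (m : nat) (k3 : R) (P Q : 'M[R]_m) : R :=
  k3 * (lambda_min Q / lambda_max P).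

Definition perturbed_system (p k1 k2 k3 : R) (d : R -> 'cV[R]_n * 'cV[R]_n)
    (t : R) (e : 'cV[R]_n * 'cV[R]_n) : 'cV[R]_n * 'cV[R]_n :=
  (- (k1 *: phi1 p k3 e.1) + e.2 + (d t).1,
   - (k2 *: phi2 p k3 e.1) + (d t).2).

Definition bounded_perturbation (dbar : R) : set (R -> 'cV[R]_n * 'cV[R]_n) :=
  [set d | forall t, norm2 (col_mx (d t).1 (d t).2) <= dbar].

End System.

(* Main.v *)
(** V = P00 |phi|^2 + 2 P01 phi.e2 + P11 |e2|^2 with phi = phi1 e1 is a strict
    Lyapunov function outside a ball. Indeed phi2 = J phi with J the Jacobian of
    phi1, so that V' is minus the form Q* evaluated with the inner product of J,
    plus terms linear in the perturbation. Since J lies between g/2 and g, where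
    phi1 e1 = g e1, the factor g is common to dissipation and perturbation and
    V' <= - k3 as soon as V exceeds some level.

    J is singular at e1 = 0, so V need not be absolutely continuous along
    solutions that cross e1 = 0. But there V = P11 |e2|^2, hence |e2| is larger
    than the perturbation when V is above the level, and the zero of e1 is
    isolated: e2(r).e1(t) is strictly increasing in t near a crossing time r.
    Between the zeros V is absolutely continuous, and it is continuous
    everywhere, so it decreases at rate k3 as long as it is above the level. *)
Require Import Defs.
From mathcomp Require Import all_boot all_order all_algebra.
From mathcomp Require Import mxtens complex.
From mathcomp Require Import all_classical all_reals all_analysis.
From mathcomp Require Import measurable_realfun.
From mathcomp Require Import ring lra.
Import Order.TTheory GRing.Theory Num.Theory.
Import numFieldNormedType.Exports.
Local Open Scope classical_set_scope.
Local Open Scope ring_scope.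
Set Implicit Arguments.
Unset Strict Implicit.
Unset Printing Implicit Defensive.

(** * Monotonicity from an almost everywhere derivative bound *)

(** Continuous induction: the points [z] with [Q a z] have a supremum, and the local property there,
    glued by transitivity, would carry [Q a] past it unless it is [b]. *)
Lemma interval_induction (R : realType) (Q : R -> R -> Prop) (a b : R) :
  a <= b ->
  (forall x y z, a <= x -> x <= y -> y <= z -> z <= b ->
     Q x y -> Q y z -> Q x z) ->
  (forall r, a <= r -> r <= b -> exists2 eta : R, 0 < eta &
     forall x y, a <= x -> r - eta < x -> x <= r -> r <= y -> y < r + eta ->
       y <= b -> Q x y) ->
  Q a b.
Proof.
move=> ab Qtrans Qloc.
pose S := [set z : R | [/\ a <= z, z <= b & Q a z]].
have Sa : S a.
  split=> //; have [eta eta0] := Qloc a (lexx a) ab.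
  by apply=> //; rewrite ?ltrBlDr ?ltrDl.
have Sub : ubound S b by move=> z [].
have hS : has_sup S by split; [exists a|exists b].
have ar : a <= sup S by apply: ub_le_sup Sa; exists b.
have rb : sup S <= b by apply: ge_sup => //; exists a.
have [eta eta0 Qeta] := Qloc _ ar rb.
have [x [ax xb Qx] rx] := sup_adherent eta0 hS.
have xr : x <= sup S by apply: ub_le_sup; [exists b|split].
(* A point strictly beyond the supremum, unless [b] comes first. *)
pose y := Num.min b (sup S + eta / 2).
have ry : sup S <= y by rewrite le_min rb lerDl divr_ge0// ltW.
have yb : y <= b by rewrite ge_min lexx.
have yr : y < sup S + eta by rewrite gt_min; apply/orP; right; lra.
have Qy : Q a y.
  apply: (Qtrans _ x) => //; first exact: le_trans xr ry.
  exact: Qeta.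
have : y <= sup S.
  by apply: ub_le_sup; [exists b|split=> //; exact: le_trans ar ry].
rewrite {1}/y ge_min => /orP[br|]; last by lra.
suff -> : b = y by [].
by apply/eqP; rewrite eq_le yb andbT (le_trans br).
Qed.

(** Straddle lemma: near [t] both one-sided slopes are below [d + e], and the increments over
    [[x, t]] and [[t, y]] add up. *)
Lemma is_derive_straddle (R : realType) (f : R -> R) (t d e : R) :
  is_derive t 1 f d -> 0 < e ->
  exists2 eta : R, 0 < eta & forall x y,
    t - eta < x -> x <= t -> t <= y -> y < t + eta ->
    f y - f x <= (d + e) * (y - x).
Proof.
move=> [df dE] e0; move: df; rewrite /derivable => /cvgP/= df.
have {}df : h^-1 *: (f (h *: 1 + t) - f t) @[h --> 0^'] --> d.
  by rewrite -dE; exact: df.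
have /= [eta eta0 H] := (@cvgrPdist_lt _ _ _ _ _ _ _).1 df e e0.
exists eta => // x y tx xt ty yt.
have Hh h : h != 0 -> `|h| < eta -> `|d - h^-1 * (f (t + h) - f t)| < e.
  move=> h0 heta; have := H h; rewrite /= sub0r normrN => /(_ heta h0).
  by rewrite /GRing.scale/= mulr1 [h + t]addrC.
have Hr : f y - f t <= (d + e) * (y - t).
  have [->|ny] := eqVneq y t; first by rewrite !subrr mulr0.
  have yt0 : 0 < y - t by rewrite subr_gt0 lt_neqAle eq_sym ny.
  have := Hh (y - t); rewrite (addrC t) subrK gt_eqF// gtr0_norm// => /(_ isT).
  have -> : y - t < eta by lra.
  move=> /(_ isT); rewrite ltr_norml => /andP[H1 _].
  rewrite -ler_pdivrMr// mulrC; lra.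
have Hl : f t - f x <= (d + e) * (t - x).
  have [->|nx] := eqVneq x t; first by rewrite !subrr mulr0.
  have yt0 : x - t < 0 by rewrite subr_lt0 lt_neqAle nx.
  have := Hh (x - t); rewrite (addrC t) subrK lt_eqF// ltr0_norm// => /(_ isT).
  have -> : - (x - t) < eta by lra.
  move=> /(_ isT); rewrite ltr_norml => /andP[H1 _].
  have : (x - t)^-1 * (f x - f t) <= d + e by lra.
  rewrite mulrC ler_ndivrMr//; lra.
have := lerD Hl Hr; lra.
Qed.

Lemma sum_le_measure_open (R : realType) (U : set R) (m : nat)
    (u v : 'I_m -> R) :
  open U -> (forall i, u i <= v i) -> (forall i, `[u i, v i] `<=` U) ->
  trivIset setT (fun i => `]u i, v i[%classic) ->
  ((\sum_(i < m) (v i - u i))%:E <= lebesgue_measure U)%E.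
Proof.
move=> oU uv uvU tuv.
have -> : ((\sum_(i < m) (v i - u i))%:E =
    \sum_(i < m) lebesgue_measure (`]u i, v i[%classic))%E.
  rewrite -sumEFin; apply: eq_bigr => i _.
  rewrite lebesgue_measure_itv/= lte_fin lt_neqAle uv andbT.
  by case: eqP => //= ->; rewrite subrr.
rewrite -measure_semi_additive_ord//=.
  apply: le_measure; rewrite ?inE//.
  - by apply: bigsetU_measurable.
  - exact: open_measurable.
  - apply: (big_ind (fun A => A `<=` U)) => [|A B AU BU|i _].
    + exact: sub0set.
    + by rewrite subUset.
    + by apply: subset_trans (uvU i); exact: subset_itv_oo_cc.
by apply: bigsetU_measurable.
Qed.

(* Gauge argument: an open set of small measure contains the exceptional points,
   and absolute continuity controls f over intervals inside of it. The finite
   family of these intervals is a list sorted from left to right. *)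
Lemma le_of_derive_ae_le (R : realType) (f : R -> R) (a b l : R) :
  a <= b -> abs_continuous_on a b f ->
  {ae (@lebesgue_measure R), forall t : R, a < t -> t < b ->
     exists2 d, is_derive t (1 : R) f d & d <= l} ->
  f b - f a <= l * (b - a).
Proof.
move=> ab ACf [A [mA A0 AP]].
apply/ler_addgt0Pr => e e0.
(* The error [e] has three equal shares: excess slope at the good points, variation of [f] inside
   the small open set, and [|l|] times the length spent there. Adding 1 keeps the denominators
   positive. *)
pose k := e / 3 / (b - a + 1).
have ba1 : 0 < b - a + 1 by lra.
have k0 : 0 < k by rewrite !divr_gt0.
have e30 : 0 < e / 3 by rewrite divr_gt0.
have [del del0 ACdel] := ACf _ e30.
pose del' := Num.min del (e / 3 / (`|l| + 1)).
have l1 : 0 < `|l| + 1 by rewrite ltr_wpDl.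
have del'0 : 0 < del' by rewrite lt_min del0 !divr_gt0.
pose mu : measure _ R := @lebesgue_measure R.
(* The endpoints are exceptional too, as the derivative bound only concerns the open interval. *)
pose E := A `|` [set a] `|` [set b].
have mE : measurable E.
  by apply: measurableU => //; exact: measurableU.
have E0 : mu E = 0%E.
  apply/(negligibleP _ mE); apply: negligibleU; first apply: negligibleU.
  - exact/negligibleP.
  - by apply/negligibleP => //; exact: lebesgue_measure_set1.
  - by apply/negligibleP => //; exact: lebesgue_measure_set1.
have Eoo : (mu E < +oo)%E by rewrite E0.
have [U [oU EU muU]] := lebesgue_regularity_outer mE Eoo del'0.
have {}muU : (lebesgue_measure U < del'%:E)%E.
  have mU := open_measurable oU.
  have H0 : (mu E + mu (U `\` E) <= mu (U `\` E))%E by rewrite E0 add0e.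
  have H1 : (mu U <= mu E + mu (U `\` E))%E.
    rewrite -{1}(setDUK EU); apply: measureU2 => //; exact: measurableD.
  exact: le_lt_trans (le_trans H1 H0) muU.
(* The list [s] holds the intervals around exceptional points. The term with [|l|] makes up for
   charging slope [l] over these intervals as well. *)
pose len (s : seq (R * R)) (x y : R) :=
  [/\ all (fun i => (x <= i.1) && (i.1 <= i.2) && (i.2 <= y)) s,
      pairwise (fun i j => i.2 <= j.1) s,
      (forall i, i \in s -> `[i.1, i.2] `<=` U) &
      f y - f x <= (l + k) * (y - x) +
        \sum_(i <- s) (`|f i.2 - f i.1| + `|l| * (i.2 - i.1))].
have [s [sab sP sU fs]] : exists s, len s a b.
  apply: (@interval_induction _ (fun x y => exists s, len s x y) _ _ ab).
    move=> x y z ax xy yz zb [s [sb sP sU fs]] [s' [sb' sP' sU' fs']].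
    exists (s ++ s'); split.
    - rewrite all_cat; apply/andP; split.
        by apply: sub_all sb => i /andP[-> /le_trans]; apply.
      by apply: sub_all sb' => i /andP[/andP[/(le_trans xy) -> ->] ->].
    - rewrite pairwise_cat sP sP' !andbT.
      apply/allrelP => i j /(allP sb)/andP[_ iy] /(allP sb')/andP[/andP[yj _] _].
      exact: le_trans iy yj.
    - by move=> i; rewrite mem_cat => /orP[/sU|/sU'].
    - by rewrite big_cat/=; lra.
  (* Near an exceptional point the interval itself is listed; near any other point the straddle
     lemma needs no list. *)
  move=> r ar rb; have [rE|rE] := pselect (E r).
    have [eta /= eta0 Ueta] := oU r (EU r rE).
    exists eta => // x y ax rx xr ry yr yb; exists [:: (x, y)]; split=> //.
    - by rewrite /= !lexx (le_trans xr ry).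
    - move=> i; rewrite inE => /eqP -> z /=; rewrite in_itv/= => /andP[xz zy].
      by apply: Ueta; rewrite /ball/= ltr_distlC; apply/andP; split; lra.
    - rewrite big_seq1/= addrCA (le_trans (ler_norm _))// lerDl -mulrDl.
      rewrite mulr_ge0 ?subr_ge0 ?(le_trans xr ry)//.
      by rewrite addrAC addr_ge0 ?(ltW k0)// -lerBlDl sub0r ler_normr lexx orbT.
  have [d fd dl] : exists2 d, is_derive r 1 f d & d <= l.
    have ra : a < r.
      by rewrite lt_neqAle ar andbT; apply/eqP => ra; apply: rE; left; right.
    have rb' : r < b.
      by rewrite lt_neqAle rb andbT; apply/eqP => rb'; apply: rE; right.
    apply: contrapT => H; apply: rE; left; left; apply: AP => /=.
    by move=> /(_ ra rb').
  have [eta eta0 H] := is_derive_straddle fd k0.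
  exists eta => // x y ax rx xr ry yr yb; exists [::]; split=> //.
  rewrite big_nil addr0 (le_trans (H _ _ _ _ _ _))// ler_wpM2r ?lerD2r//.
  by rewrite subr_ge0 (le_trans xr).
pose u (i : 'I_(size s)) := (nth (0, 0) s i).1.
pose v (i : 'I_(size s)) := (nth (0, 0) s i).2.
have Hin i : [/\ a <= u i, u i <= v i & v i <= b].
  by have /andP[/andP[]] := allP sab (nth (0, 0) s i) (mem_nth _ (ltn_ord i)).
have Htriv : trivIset setT (fun i => `]u i, v i[%classic).
  move=> i j _ _ [z [/=]]; rewrite !in_itv/= => /andP[uiz ziv] /andP[ujz zjv].
  have {sP}/(pairwiseP (0, 0)) sP := sP.
  apply/val_inj/eqP; rewrite eqn_leq; apply/andP; split; rewrite leqNgt;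
    apply/negP => ij.
    have := sP _ _ (ltn_ord j) (ltn_ord i) ij; rewrite -/(v j) -/(u i); lra.
  have := sP _ _ (ltn_ord i) (ltn_ord j) ij; rewrite -/(v i) -/(u j); lra.
have Hlen : \sum_(i < size s) (v i - u i) < del'.
  rewrite -lte_fin; apply: le_lt_trans muU; apply: sum_le_measure_open => //.
    by move=> i; case: (Hin i).
  by move=> i; apply: sU; exact: mem_nth.
have H1 : \sum_(i < size s) `|f (v i) - f (u i)| < e / 3.
  apply: ACdel => //; first by move=> i; case: (Hin i).
  by rewrite (lt_le_trans Hlen)// ge_min lexx.
have H2 : `|l| * \sum_(i < size s) (v i - u i) <= e / 3.
  apply: (@le_trans _ _ ((`|l| + 1) * del')); last first.
    by rewrite mulrC -ler_pdivlMr// ge_min lexx orbT.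
  apply: (@le_trans _ _ (`|l| * del')); first by rewrite ler_wpM2l// ltW.
  by rewrite ler_wpM2r ?(ltW del'0)// lerDl.
have H3 : k * (b - a) <= e / 3.
  apply: (@le_trans _ _ (k * (b - a + 1))).
    by rewrite ler_wpM2l ?(ltW k0)// lerDl.
  by rewrite divfK ?gt_eqF.
move: fs; rewrite big_split/= -mulr_sumr (big_nth (0, 0)) big_mkord.
rewrite (big_nth (0, 0)) big_mkord -/u => fs.
apply: (le_trans fs); rewrite mulrDl.
move: H1 H2 H3; rewrite /u /v; lra.
Qed.

(** * The Lyapunov inequality *)

Definition dot (R : realType) (n : nat) (u v : 'cV[R]_n) : R :=
  \sum_i u i 0 * v i 0.

Section Dot.
Variables (R : realType) (n : nat).
Implicit Types u v w : 'cV[R]_n.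

Lemma sqnorm2E u : sqnorm2 u = dot u u.
Proof. by rewrite /sqnorm2 mxE; apply: eq_bigr => i _; rewrite mxE. Qed.

Lemma dotC u v : dot u v = dot v u.
Proof. by apply: eq_bigr => i _; rewrite mulrC. Qed.

Lemma dotDl u v w : dot (u + v) w = dot u w + dot v w.
Proof. by rewrite -big_split; apply: eq_bigr => i _; rewrite mxE mulrDl. Qed.

Lemma dotDr u v w : dot u (v + w) = dot u v + dot u w.
Proof. by rewrite !(dotC u) dotDl. Qed.

Lemma dotZl k u v : dot (k *: u) v = k * dot u v.
Proof. by rewrite mulr_sumr; apply: eq_bigr => i _; rewrite mxE mulrA. Qed.

Lemma dotZr k u v : dot u (k *: v) = k * dot u v.
Proof. by rewrite !(dotC u) dotZl. Qed.

Lemma dotNl u v : dot (- u) v = - dot u v.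
Proof. by rewrite -scaleN1r dotZl mulN1r. Qed.

Lemma dotNr u v : dot u (- v) = - dot u v.
Proof. by rewrite !(dotC u) dotNl. Qed.

Lemma dot0r u : dot u 0 = 0.
Proof. by rewrite -(scale0r (0 : 'cV_n)) dotZr mul0r. Qed.

Lemma dot_ge0 u : 0 <= dot u u.
Proof. by apply: sumr_ge0 => i _; rewrite -expr2 sqr_ge0. Qed.

Lemma sqr_coord_le u i : u i 0 ^+ 2 <= dot u u.
Proof.
rewrite /dot (bigD1 i)//= expr2 lerDl sumr_ge0// => j _.
by rewrite -expr2 sqr_ge0.
Qed.

Lemma dot_eq0 u : (dot u u == 0) = (u == 0).
Proof.
apply/eqP/eqP => [u0|->]; last by rewrite dot0r.
apply/matrixP => i j; rewrite (ord1 j) !mxE; apply/eqP.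
by rewrite -sqrf_eq0 eq_le sqr_ge0 -u0 sqr_coord_le.
Qed.

Lemma dot_gt0 u : u != 0 -> 0 < dot u u.
Proof. by move=> u0; rewrite lt_neqAle dot_ge0 eq_sym dot_eq0 u0. Qed.

(** Cauchy-Schwarz: the square of [dot v v *: u - dot u v *: v] is [dot v v] times the difference of
    the two sides. *)
Lemma dot_sqr_le u v : dot u v ^+ 2 <= dot u u * dot v v.
Proof.
have [->|v0] := eqVneq v 0; first by rewrite !dot0r expr0n mulr0.
have := dot_ge0 (dot v v *: u - dot u v *: v).
rewrite !(dotDl, dotDr, dotNl, dotNr, dotZl, dotZr) (dotC v u) => H.
rewrite -subr_ge0 -(pmulr_rge0 _ (dot_gt0 v0)).
by apply: le_trans H _; lra.
Qed.

End Dot.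

(** * Inner products weighted by the Jacobian *)

Section Weighted.
Variables (R : realType) (n : nat).
Implicit Types (u v x : 'cV[R]_n) (g b : R).

(* The Jacobian of [phi1] at [x] is of the form [g I + b x x^T]. *)
Definition wdot g b x u v : R := g * dot u v + b * dot x u * dot x v.

Variables (g b : R) (x : 'cV[R]_n).
Hypotheses (g0 : 0 < g) (b0 : b <= 0) (r0 : 0 <= g + b * dot x x).
Local Notation J := (wdot g b x).

Lemma wdot_le u : J u u <= g * dot u u.
Proof. by rewrite /wdot -mulrA -expr2 gerDl mulr_le0_ge0 ?sqr_ge0. Qed.

(** As [b <= 0], the rank-one part lowers the form; by Cauchy-Schwarz it does so most along [x],
    where the eigenvalue is [g + b * dot x x]. *)
Lemma wdot_ge u : (g + b * dot x x) * dot u u <= J u u.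
Proof.
rewrite /wdot mulrDl lerD2l -!mulrA -expr2 ler_wnM2l//.
exact: dot_sqr_le.
Qed.

Lemma wdot_ge0 u : 0 <= J u u.
Proof. by apply: le_trans (wdot_ge u); rewrite mulr_ge0 ?dot_ge0. Qed.

Lemma wdotBB h k u v : J (h *: u - k *: v) (h *: u - k *: v) =
  h ^+ 2 * J u u - 2 * h * k * J u v + k ^+ 2 * J v v.
Proof.
rewrite /wdot !(dotDl, dotDr, dotNl, dotNr, dotZl, dotZr) (dotC v u); ring.
Qed.

(** Expand the square of [m *: u - c *: v] and divide by [m]. This absorbs cross terms with the
    perturbation into the dissipation. *)
Lemma wdot_amgm m c u v : 0 < m ->
  2 * c * J u v <= m * J u u + c ^+ 2 / m * J v v.
Proof.
move=> m0; have := wdot_ge0 (m *: u - c *: v); rewrite wdotBB => H.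
rewrite -subr_ge0 -(pmulr_rge0 _ m0); apply: le_trans H _.
by rewrite le_eqVlt; apply/orP; left; apply/eqP; field; rewrite gt_eqF.
Qed.

(* The determinant over the trace is a lower bound of the smallest eigenvalue. *)
Lemma wdot_posdef_ge (Q0 Q1 Q01 : R) u v :
  0 < Q0 -> 0 < Q1 -> 0 < Q0 * Q1 - Q01 ^+ 2 ->
  (Q0 * Q1 - Q01 ^+ 2) / (Q0 + Q1) * (J u u + J v v) <=
  Q0 * J u u + 2 * Q01 * J u v + Q1 * J v v.
Proof.
move=> Q00 Q10 D0; have T0 : 0 < Q0 + Q1 by rewrite addr_gt0.
rewrite -subr_ge0 -(pmulr_rge0 _ T0).
(* By Cayley-Hamilton, trace times the matrix minus determinant times the identity is its square, so
   the gap is the sum of the squares of its two rows applied to [(u, v)]. *)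
have := wdot_ge0 (Q0 *: u - (- Q01) *: v).
have := wdot_ge0 (Q01 *: u - (- Q1) *: v).
rewrite !wdotBB => H1 H2; apply: le_trans (addr_ge0 H1 H2) _.
by rewrite le_eqVlt; apply/orP; left; apply/eqP; field; rewrite gt_eqF.
Qed.

End Weighted.

Lemma dot_amgm (R : realType) n (m c : R) (u v : 'cV[R]_n) : 0 < m ->
  2 * c * dot u v <= m * dot u u + c ^+ 2 / m * dot v v.
Proof.
have r0 : 0 <= 1 + 0 * dot (0 : 'cV[R]_n) 0 by rewrite mul0r addr0.
have := @wdot_amgm R n 1 0 0 (lexx _) r0 m c u v.
by rewrite /wdot !mul1r !mul0r !addr0.
Qed.

(** * The dissipation estimate *)

Section LyapunovRate.
Variables (R : realType) (n : nat) (P0 P01 P1 k1 k2 k3 D : R).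

(* The entries of [Q*], as given by the Lyapunov equation. *)
Definition Qform00 := 2 * (k1 * P0 + k2 * P01).
Definition Qform01 := k1 * P01 + k2 * P1 - P0.
Definition Qform11 := - 2 * P01.
Definition coercivity :=
  (Qform00 * Qform11 - Qform01 ^+ 2) / (Qform00 + Qform11).
(* AM-GM spends a sixth of the dissipation [coercivity] on each of the
   perturbation terms. *)
Definition perturbation_gain :=
  (P0 ^+ 2 + P01 ^+ 2 + (P01 ^+ 2 + P1 ^+ 2) / k3 ^+ 2) / (coercivity / 6).
(** The first summand lets a quarter of the dissipation beat the perturbation, with 1 to spare for
    the rate. The second keeps the threshold above [D], which isolates the zeros of [e1]. *)
Definition threshold := 4 / coercivity * (perturbation_gain * D + 1) + D.

Hypotheses (Q00 : 0 < Qform00) (Q10 : 0 < Qform11).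
Hypothesis detQ : 0 < Qform00 * Qform11 - Qform01 ^+ 2.
Hypotheses (k30 : 0 < k3) (D0 : 0 <= D).

Lemma coercivity_gt0 : 0 < coercivity.
Proof. by rewrite divr_gt0// addr_gt0. Qed.

Lemma perturbation_gain_ge0 : 0 <= perturbation_gain.
Proof.
have q0 := coercivity_gt0.
apply: divr_ge0; last by apply: ltW; rewrite divr_gt0.
by rewrite addr_ge0 ?divr_ge0 ?addr_ge0 ?sqr_ge0.
Qed.

Lemma threshold_gt : D < threshold.
Proof.
have q0 := coercivity_gt0; have K0 := perturbation_gain_ge0.
rewrite ltrDr; apply: mulr_gt0; first by rewrite divr_gt0.
by have := mulr_ge0 K0 D0; lra.
Qed.

Lemma lyapunov_rate (g b : R) (x e v1 v2 d1 d2 : 'cV[R]_n) :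
  let r := g + b * dot x x in
  k3 <= g -> b <= 0 -> g / 2 <= r ->
  dot v1 v1 <= D -> dot v2 v2 <= D ->
  threshold <= g ^+ 2 * dot x x + dot e e ->
  d1 = - (k1 *: (g *: x)) + e + v1 ->
  d2 = - (k2 *: ((r * g) *: x)) + v2 ->
  P0 * (2 * g * (b * dot x d1) * dot x x + g ^+ 2 * (2 * dot x d1)) +
  2 * P01 * (b * dot x d1 * dot x e + g * (dot d1 e + dot x d2)) +
  P1 * (2 * dot e d2) <= - k3.
Proof.
move=> r kg b0 gr v1D v2D thr -> ->.
have g0 : 0 < g by exact: lt_le_trans kg.
have r0 : 0 <= g + b * dot x x by apply: le_trans gr; rewrite divr_ge0// ltW.
set q := coercivity; have q0 : 0 < q := coercivity_gt0.
pose m := q / 6; have m0 : 0 < m by rewrite divr_gt0.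
pose J := wdot g b x; pose f := g *: x.
pose N := dot f f + dot e e.
have NE : N = g ^+ 2 * dot x x + dot e e by rewrite /N !dotZl !dotZr mulrA expr2.
set L := (X in X <= _).
(* Since [r] is the eigenvalue of the Jacobian along [x], the quadratic terms assemble into the form
   of [Q*] in the product [J]. Dividing by [g] under the bracket gives the [v2] terms the common
   factor [g]. *)
have -> : L = - (Qform00 * J f f + 2 * Qform01 * J f e + Qform11 * J e e) +
    (2 * P0 * J f v1 + 2 * P01 * J e v1 +
     g * (2 * (P01 / g) * dot f v2 + 2 * (P1 / g) * dot e v2)).
  rewrite /L /Qform00 /Qform01 /Qform11 /J /wdot /f /r.
  rewrite !(dotDl, dotDr, dotNl, dotNr, dotZl, dotZr) (dotC e x) (dotC v1 e).
  by field; rewrite gt_eqF.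
have HQ : q * (J f f + J e e) <= _ := wdot_posdef_ge b0 r0 f e Q00 Q10 detQ.
have Jge u : g / 2 * dot u u <= J u u.
  by apply: le_trans (wdot_ge _ _ b0 u); rewrite ler_wpM2r ?dot_ge0.
have Jv1 : J v1 v1 <= g * D.
  by apply: le_trans (wdot_le _ _ b0 v1) _; rewrite ler_wpM2l ?(ltW g0).
have sq c : c ^+ 2 / m * J v1 v1 <= c ^+ 2 / m * (g * D).
  by rewrite ler_wpM2l// divr_ge0 ?sqr_ge0 ?(ltW m0).
have H1 := le_trans (wdot_amgm b0 r0 P0 f v1 m0) (lerD (lexx _) (sq P0)).
have H2 := le_trans (wdot_amgm b0 r0 P01 e v1 m0) (lerD (lexx _) (sq P01)).
have sq2 c : (c / g) ^+ 2 / m * dot v2 v2 <= c ^+ 2 / k3 ^+ 2 / m * D.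
  have m0' : 0 <= m^-1 by rewrite invr_ge0 ltW.
  apply: ler_pM => //; [exact: mulr_ge0 (sqr_ge0 _) m0'|exact: dot_ge0|].
  rewrite (ler_wpM2r m0')// expr_div_n ler_wpM2l ?sqr_ge0//.
  by rewrite lef_pV2 ?posrE ?exprn_gt0// ler_sqr ?nnegrE ?(ltW g0) ?(ltW k30).
have H3 := le_trans (dot_amgm (P01 / g) f v2 m0) (lerD (lexx _) (sq2 P01)).
have H4 := le_trans (dot_amgm (P1 / g) e v2 m0) (lerD (lexx _) (sq2 P1)).
have H34 := ler_wpM2l (ltW g0) (lerD H3 H4).
have HJ : g / 2 * N <= J f f + J e e by rewrite mulrDr lerD.
(* Of the dissipation [6 * m], [H1] and [H2] take [m]. The other five are worth [5 / 2 * m * g * N],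
   of which [H34] takes [m * g * N]; what remains is the [q / 4] of [NK], times [g * N]. *)
have H5 := ler_wpM2l (ltW (mulr_gt0 (ltr0Sn R 4) m0)) HJ.
have KE : perturbation_gain * D * g =
    P0 ^+ 2 / m * (g * D) + P01 ^+ 2 / m * (g * D) +
    g * (P01 ^+ 2 / k3 ^+ 2 / m * D + P1 ^+ 2 / k3 ^+ 2 / m * D).
  by rewrite /perturbation_gain -/q -/m; field; rewrite !gt_eqF.
have NK : perturbation_gain * D + 1 <= q / 4 * N.
  rewrite NE; apply: (@le_trans _ _ (q / 4 * threshold)); last first.
    by rewrite ler_wpM2l// divr_ge0// ltW.
  rewrite /threshold -/q mulrDr mulrA (_ : q / 4 * (4 / q) = 1); last first.
    by field; rewrite gt_eqF.
  by rewrite mul1r lerDl mulr_ge0// divr_ge0// ltW.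
have NKg := ler_wpM2r (ltW g0) NK.
move: HQ H1 H2 H34 H5 KE NKg; rewrite -/J -/N (_ : q = 6 * m); last first.
  by rewrite /m; field.
move: kg; rewrite /N; lra.
Qed.

End LyapunovRate.

(** * Absolute continuity, Lipschitz functions and derivatives *)

Section AbsoluteContinuity.
Variable R : realType.

Lemma abs_continuous_on_sub (V : normedModType R) (x : R -> V) (a b c d : R) :
  a <= c -> d <= b -> abs_continuous_on a b x -> abs_continuous_on c d x.
Proof.
move=> ac db ACx e e0; have [del del0 H] := ACx e e0; exists del => // m u v uv.
apply: H => i; have [cu [? vd]] := uv i.
by rewrite (le_trans ac) ?(le_trans vd).
Qed.

Lemma abs_continuous_on_dominated (V W : normedModType R) (x : R -> V)
    (y : R -> W) (a b M : R) :
  abs_continuous_on a b x ->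
  (forall s t, a <= s -> s <= t -> t <= b ->
    `|y t - y s| <= M * `|x t - x s|) ->
  abs_continuous_on a b y.
Proof.
move=> ACx yx e e0.
have M1 : 0 < `|M| + 1 by rewrite ltr_wpDl.
have [del del0 H] := ACx _ (divr_gt0 e0 M1); exists del => //.
move=> m u v uv tuv uvdel.
have := H m u v uv tuv uvdel; rewrite ltr_pdivlMr// => /(le_lt_trans _); apply.
rewrite mulr_suml; apply: ler_sum => i _; have [au [uivi vb]] := uv i.
apply: le_trans (yx _ _ au uivi vb) _; rewrite mulrC ler_wpM2l//.
by rewrite (le_trans (ler_norm _))// lerDl.
Qed.

Lemma abs_continuous_on_dist (V : normedModType R) (x : R -> V) (a b e : R) :
  abs_continuous_on a b x -> 0 < e -> exists2 del : R, 0 < del &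
    forall s t, a <= s -> s <= b -> a <= t -> t <= b -> `|s - t| < del ->
      `|x s - x t| < e.
Proof.
move=> ACx e0; have [del del0 H] := ACx e e0; exists del => //.
have {}H s t : a <= s -> s <= t -> t <= b -> `|s - t| < del -> `|x s - x t| < e.
  move=> sa st tb std; have := H 1%N (fun=> s) (fun=> t).
  rewrite !big_ord1 distrC; apply => //.
    by move=> i j _ _ _; rewrite (ord1 i) (ord1 j).
  by rewrite (le_lt_trans (ler_norm _))// distrC.
move=> s t sa sb ta tb; case: (leP s t) => [st|/ltW ts]; first exact: H.
by rewrite distrC (distrC (x s)); exact: H.
Qed.

(** Clamping to [[a, b]] is 1-Lipschitz. The result is a curve on the whole line, to which global
    continuity lemmas apply. *)
Lemma abs_continuous_on_cst_outside (V : normedModType R) (x : R -> V)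
    (a b : R) :
  a <= b -> abs_continuous_on a b x ->
  continuous (fun t => x (Num.max a (Num.min b t))).
Proof.
move=> ab ACx t; apply/cvgrPdist_lt => e e0.
have [del del0 H] := abs_continuous_on_dist ACx e0.
apply/nbhs_ballP; exists del => //= s; rewrite /ball/= => std.
have range r : a <= Num.max a (Num.min b r) <= b.
  by rewrite le_max lexx ge_max ab ge_min lexx.
have /andP[ta tb] := range t; have /andP[sa sb] := range s.
apply: H => //; apply: le_lt_trans std.
have dmax u v : `|Num.max a u - Num.max a v| <= `|u - v|.
  have n1 := ler_norm (u - v); have n2 := ler_norm (v - u).
  rewrite distrC in n2; rewrite !maxEle ler_norml.
  by apply/andP; split; case: (leP a u) => ?; case: (leP a v) => ?; lra.
have dmin u v : `|Num.min b u - Num.min b v| <= `|u - v|.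
  have n1 := ler_norm (u - v); have n2 := ler_norm (v - u).
  rewrite distrC in n2; rewrite !minEle ler_norml.
  by apply/andP; split; case: (leP b u) => ?; case: (leP b v) => ?; lra.
exact: le_trans (dmax _ _) (dmin _ _).
Qed.

End AbsoluteContinuity.

(** Mean value theorem: for [a <= 0] the absolute derivative decreases, so it is largest at [m]. *)
Lemma powR_lipschitz (R : realType) (m a : R) : 0 < m -> a <= 0 ->
  forall s t, m <= s -> m <= t ->
  `|s `^ a - t `^ a| <= `|a| * m `^ (a - 1) * `|s - t|.
Proof.
move=> m0 a0; suff H s t : m <= s -> s <= t ->
    `|t `^ a - s `^ a| <= `|a| * m `^ (a - 1) * `|t - s|.
  move=> s t ms mt; case: (leP s t) => [|/ltW] st; last exact: H.
  by rewrite distrC (distrC s); exact: H.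
move=> ms st.
have s0 : 0 < s by exact: lt_le_trans ms.
have dpow c : s <= c -> is_derive c 1 (@powR R ^~ a) (a * c `^ (a - 1)).
  by move=> sc; apply: is_derive1_powR; exact: lt_le_trans sc.
have [||c] := @MVT_segment R (@powR R ^~ a) (fun c => a * c `^ (a - 1)) s t st.
- by move=> c; rewrite in_itv/= => /andP[/ltW sc _]; exact: dpow.
- apply: derivable_within_continuous => c; rewrite in_itv/= => /andP[sc _].
  by case: (dpow c sc) => dc _; exact: dc.
rewrite in_itv/= => /andP[sc _] ->; rewrite !normrM ler_wpM2r//.
rewrite ler_wpM2l// ger0_norm ?powR_ge0//.
have c0 : 0 < c by exact: lt_le_trans sc.
rewrite -[a - 1]opprK [c `^ _]powRN [m `^ _]powRN.
rewrite lef_pV2 ?posrE; [|exact: powR_gt0|exact: powR_gt0].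
rewrite ge0_ler_powR ?nnegrE ?(ltW m0) ?(ltW c0) ?(le_trans ms)//; lra.
Qed.

(** * Lipschitz functions on a bounded set *)

Section LipschitzOn.
Variables (R : realType) (V : normedModType R) (K : set V).

Definition lipschitz_on (h : V -> R) :=
  exists M : R, forall u v, K u -> K v -> `|h u - h v| <= M * `|u - v|.

Hypothesis bndK : exists B : R, forall u, K u -> `|u| <= B.

Lemma lipschitz_on_bounded h :
  lipschitz_on h -> exists2 B : R, 0 <= B & forall u, K u -> `|h u| <= B.
Proof.
move=> [M hM]; have [B KB] := bndK.
have [[u0 Ku0]|noK] := pselect (exists u, K u); last first.
  by exists 0 => // u Ku; case: noK; exists u.
have B0 : 0 <= B by exact: le_trans (KB _ Ku0).
exists (`|h u0| + `|M| * (B + B)); first by rewrite addr_ge0 ?mulr_ge0 ?addr_ge0.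
move=> u Ku; rewrite -[h u](subrK (h u0)) addrC.
apply: le_trans (ler_normD _ _) _; rewrite lerD2l.
apply: le_trans (hM _ _ Ku Ku0) _.
apply: le_trans (ler_wpM2r (normr_ge0 _) (ler_norm M)) _.
rewrite ler_wpM2l// (le_trans (ler_normB _ _))//.
exact: lerD (KB _ Ku) (KB _ Ku0).
Qed.

Lemma lipschitz_on_cst (k : R) : lipschitz_on (fun=> k).
Proof. by exists 0 => u v _ _; rewrite subrr normr0 mul0r. Qed.

Lemma lipschitz_onD h h' : lipschitz_on h -> lipschitz_on h' ->
  lipschitz_on (fun u => h u + h' u).
Proof.
move=> [M hM] [M' hM']; exists (M + M') => u v Ku Kv.
rewrite /= opprD addrACA mulrDl (le_trans (ler_normD _ _))//.
by apply: lerD; [exact: hM|exact: hM'].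
Qed.

Lemma lipschitz_onM h h' : lipschitz_on h -> lipschitz_on h' ->
  lipschitz_on (fun u => h u * h' u).
Proof.
move=> lh lh'; have [B B0 hB] := lipschitz_on_bounded lh.
have [B' B'0 hB'] := lipschitz_on_bounded lh'.
have [[M hM] [M' hM']] := (lh, lh').
exists (B * M' + M * B') => u v Ku Kv; rewrite /=.
rewrite (_ : _ - _ = h u * (h' u - h' v) + (h u - h v) * h' v); last by ring.
rewrite (le_trans (ler_normD _ _))// [leRHS]mulrDl !normrM lerD//.
  by rewrite -mulrA ler_pM// ?hB ?hM'.
by rewrite mulrAC ler_pM// ?hB' ?hM.
Qed.

Lemma lipschitz_on_sum (I : Type) (r : seq I) (F : I -> V -> R) :
  (forall i, lipschitz_on (F i)) -> lipschitz_on (fun u => \sum_(i <- r) F i u).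
Proof.
move=> lF; elim: r => [|i r IH].
  by under eq_fun do rewrite big_nil; exact: lipschitz_on_cst.
by under eq_fun do rewrite big_cons; exact: lipschitz_onD.
Qed.

Lemma lipschitz_on_powR (m a : R) h : 0 < m -> a <= 0 ->
  (forall u, K u -> m <= h u) -> lipschitz_on h ->
  lipschitz_on (fun u => h u `^ a).
Proof.
move=> m0 a0 mh [M hM]; exists (`|a| * m `^ (a - 1) * M) => u v Ku Kv.
apply: le_trans (powR_lipschitz m0 a0 (mh _ Ku) (mh _ Kv)) _.
by rewrite -[leRHS]mulrA ler_wpM2l ?hM// mulr_ge0 ?powR_ge0.
Qed.

End LipschitzOn.

(** * Derivatives and continuity of scalar products *)

Section DotCalculus.
Variables (R : realType) (n : nat).

(** Linearity is asked for in the shape of a difference quotient, with which [L] then commutes; this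
    serves coordinates and projections. *)
Lemma is_derive_linear (V W : normedModType R) (L : V -> W) (x : R -> V) (t : R)
    (d : V) :
  (forall k u v, L (k *: (u - v)) = k *: (L u - L v)) -> continuous L ->
  is_derive t 1 x d -> is_derive t 1 (L \o x) (L d).
Proof.
move=> linL cL [dx xd].
have {}dx : h^-1 *: (x (h *: 1 + t) - x t) @[h --> 0^'] --> d.
  by rewrite -xd; exact: dx.
have H : h^-1 *: ((L \o x) (h *: 1 + t) - (L \o x) t) @[h --> 0^'] --> L d.
  under eq_fun do rewrite /= -linL.
  exact: (cvg_comp _ _ dx (cL d)).
split; first by apply/cvg_ex; exists (L d).
exact: cvg_lim H.
Qed.

Lemma is_derive_dot (y z : R -> 'cV[R]_n) (t : R) (dy dz : 'cV[R]_n) :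
  is_derive t 1 y dy -> is_derive t 1 z dz ->
  is_derive t 1 (fun t => dot (y t) (z t)) (dot dy (z t) + dot (y t) dz).
Proof.
move=> ydy zdz.
have coord (w : R -> 'cV[R]_n) dw i : is_derive t 1 w dw ->
    is_derive t 1 (fun s => w s i 0) (dw i 0).
  move=> wdw; apply: (@is_derive_linear _ _ (fun v : 'cV[R]_n => v i 0)) => //.
    by move=> k u v; rewrite !mxE.
  exact: coord_continuous.
rewrite /dot; have -> : (fun t => \sum_i y t i 0 * z t i 0) =
    \sum_(i < n) (fun t => y t i 0 * z t i 0).
  by apply/funext => s; rewrite fct_sumE.
have H i : is_derive t 1 (fun t => y t i 0 * z t i 0)
    (y t i 0 * dz i 0 + z t i 0 * dy i 0).
  have ? := coord y dy i ydy; have ? := coord z dz i zdz.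
  exact: is_deriveM.
apply: is_derive_eq.
rewrite -big_split; apply: eq_bigr => i _ /=; ring.
Qed.

Lemma dot_continuous (T : topologicalType) (f h : T -> 'cV[R]_n) (t : T) :
  {for t, continuous f} -> {for t, continuous h} ->
  {for t, continuous (fun s => dot (f s) (h s))}.
Proof.
move=> cf ch; rewrite /continuous_at /dot.
apply: cvg_big => [|i _]; first exact: add_continuous.
apply: cvgM.
  exact: (cvg_comp _ _ cf (@coord_continuous _ _ _ i 0 (f t))).
exact: (cvg_comp _ _ ch (@coord_continuous _ _ _ i 0 (h t))).
Qed.

Lemma norm_cV_le (v : 'cV[R]_n) (c : R) : 0 <= c ->
  (forall i, `|v i 0| <= c) -> `|v| <= c.
Proof.
move=> c0 vc; rewrite [leLHS]/Num.Def.normr/= mx_normrE.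
by apply: bigmax_le => // -[i j] _ /=; rewrite (ord1 j).
Qed.

Lemma norm_coord_le (v : 'cV[R]_n) i : `|v i 0| <= `|v|.
Proof.
rewrite [leRHS]/Num.Def.normr/= mx_normrE.
exact: (le_bigmax _ (fun ij => `|v ij.1 ij.2|) (i, 0)).
Qed.

Lemma norm_le_sqrt_dot (v : 'cV[R]_n) : `|v| <= Num.sqrt (dot v v).
Proof.
apply: norm_cV_le => [|i]; first exact: sqrtr_ge0.
by rewrite -sqrtr_sqr ler_wsqrtr// sqr_coord_le.
Qed.

(** Only the origin is delicate: there the norm is at most [dot x x] to the power [a + 1/2], which
    is positive. *)
Lemma powR_dot_scale_continuous (a : R) : - 2^-1 < a ->
  continuous (fun x : 'cV[R]_n => dot x x `^ a *: x).
Proof.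
move=> a2 x; have [->|x0] := eqVneq x 0; last first.
  have sx := dot_gt0 x0.
  have cdot : {for x, continuous (fun y : 'cV[R]_n => dot y y)}.
    by apply: dot_continuous; exact: cvg_id.
  have cpow : {for dot x x, continuous (@powR R ^~ a)}.
    apply: differentiable_continuous; apply/derivable1_diffP.
    by case: (is_derive1_powR a sx) => dc _; exact: dc.
  have cx := @continuous_comp _ _ _ (fun y : 'cV[R]_n => dot y y) _ x cdot cpow.
  exact: (cvgZ cx cvg_id).
rewrite /continuous_at scaler0.
apply: (@cvgrPdist_lt _ _ _ _ (nbhs_filter (0 : 'cV[R]_n)) _ _).2 => e e0.
have a20 : 0 < a + 2^-1 by lra.
have c0 : dot y y @[y --> (0 : 'cV[R]_n)] --> dot (0 : 'cV[R]_n) 0.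
  exact: (@dot_continuous 'cV[R]_n id id (0 : 'cV[R]_n) cvg_id cvg_id).
rewrite dot0r in c0.
have := (@cvgrPdist_lt _ _ _ _ (nbhs_filter (0 : 'cV[R]_n)) _ _).1 c0 _
  (powR_gt0 (a + 2^-1)^-1 e0).
apply: filterS => y; rewrite sub0r normrN ger0_norm ?dot_ge0// => ye.
rewrite sub0r normrN normrZ ger0_norm ?powR_ge0//.
have [->|y0] := eqVneq y 0; first by rewrite normr0 mulr0.
have sy := dot_gt0 y0.
apply: (@le_lt_trans _ _ (dot y y `^ (a + 2^-1))).
  rewrite powRD ?gt_eqF ?implybT// powR12_sqrt ?(ltW sy)//.
  by rewrite ler_wpM2l ?powR_ge0// norm_le_sqrt_dot.
have := gt0_ltr_powR a20 _ _ ye; rewrite !nnegrE ?(ltW sy) ?powR_ge0// -powRrM.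
by rewrite mulVf ?gt_eqF// powRr1 ?(ltW e0)//; exact.
Qed.

End DotCalculus.

(** Continuity carries a decrease in the interior over to the endpoints, which may be zeros of
    [e1]. *)
Lemma le_of_open_le (R : realType) (G : R -> R) (s t : R) : continuous G ->
  s <= t ->
  (forall u v, s < u -> u <= v -> v < t -> G v <= G u) -> G t <= G s.
Proof.
move=> cG; rewrite le_eqVlt => /orP[/eqP -> //|st] H.
rewrite leNgt; apply/negP => Gst.
pose e := (G t - G s) / 2; have e0 : 0 < e by rewrite divr_gt0// subr_gt0.
have [d1 /= d10 H1] := (@cvgrPdist_lt _ _ _ _ (nbhs_filter s) _ _).1
  (cG s) e e0.
have [d2 /= d20 H2] := (@cvgrPdist_lt _ _ _ _ (nbhs_filter t) _ _).1
  (cG t) e e0.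
(* A third of [t - s] at most, so that the two inner points stay in order. *)
pose k1 := Num.min d1 (t - s) / 3; pose k2 := Num.min d2 (t - s) / 3.
have k10 : 0 < k1 by rewrite divr_gt0// lt_min d10 subr_gt0.
have k20 : 0 < k2 by rewrite divr_gt0// lt_min d20 subr_gt0.
have k1d : k1 < d1 by rewrite ltr_pdivrMr// gt_min; apply/orP; left; lra.
have k2d : k2 < d2 by rewrite ltr_pdivrMr// gt_min; apply/orP; left; lra.
have k1s : k1 <= (t - s) / 3 by rewrite ler_pM2r// ge_min lexx orbT.
have k2s : k2 <= (t - s) / 3 by rewrite ler_pM2r// ge_min lexx orbT.
have := H (s + k1) (t - k2); rewrite ltrDl gtrBl k10 k20.
have -> : s + k1 <= t - k2 by lra.
move=> /(_ isT isT isT).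
have := H1 (s + k1); rewrite /= (_ : s - (s + k1) = - k1) ?normrN; last by ring.
rewrite gtr0_norm// => /(_ k1d).
have := H2 (t - k2); rewrite /= subKr gtr0_norm// => /(_ k2d).
by rewrite !ltr_norml /e => /andP[? ?] /andP[? ?]; lra.
Qed.

(** * Decay along trajectories *)

Section LyapunovFunction.
Variables (R : realType) (n : nat) (p k1 k2 k3 P0 P01 P1 dbar : R).
Local Notation E := ('cV[R]_n * 'cV[R]_n)%type.

Definition gain_exponent : R := (1 - p) / (3 * p - 2).
Local Notation a := gain_exponent.

Definition gain (s : R) : R := k3 + s `^ a.

Definition lyap (e : E) : R :=
  P0 * (gain (dot e.1 e.1) ^+ 2 * dot e.1 e.1) +
  2 * P01 * (gain (dot e.1 e.1) * dot e.1 e.2) + P1 * dot e.2 e.2.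

(** V is at most [P0 + P1] times the squared norm of [(phi, e2)], so above this level that norm
    exceeds the threshold. *)
Definition lyap_level : R :=
  (P0 + P1) * threshold P0 P01 P1 k1 k2 k3 (dbar ^+ 2).

Hypotheses (hp1 : 1 < p) (hp2 : p < 2) (hk3 : 0 < k3).
Hypotheses (P00 : 0 < P0) (P10 : 0 < P1) (detP : 0 < P0 * P1 - P01 ^+ 2).
Hypotheses (Q00 : 0 < Qform00 P0 P01 k1 k2) (Q10 : 0 < Qform11 P01).
Hypothesis detQ :
  0 < Qform00 P0 P01 k1 k2 * Qform11 P01 - Qform01 P0 P01 P1 k1 k2 ^+ 2.

(** The lower bound expresses [p < 2]; it keeps the Jacobian of [phi1] above half the gain. *)
Lemma gain_exponent_bounds : - 4^-1 < a < 0.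
Proof.
have h1 := hp1; have h2 := hp2; have h : 0 < 3 * p - 2 by lra.
by rewrite /a ltr_pdivlMr// ltr_pdivrMr//; apply/andP; split; lra.
Qed.

Lemma gain_ge s : k3 <= gain s.
Proof. by rewrite lerDl powR_ge0. Qed.

Lemma gain_gt0 s : 0 < gain s.
Proof. exact: lt_le_trans (gain_ge s). Qed.

Lemma phi1E (x : 'cV[R]_n) : phi1 p k3 x = gain (dot x x) *: x.
Proof. by rewrite /phi1 sqnorm2E -scalerDl. Qed.

(** Twice the derivative of [gain], hence the coefficient of [x x^T] in the Jacobian of [phi1]. *)
Definition gain_slope (s : R) : R := 2 * a * s `^ (a - 1).

Lemma gain_slope_mul s : 0 < s -> gain_slope s * s = 2 * a * s `^ a.
Proof.
move=> s0; rewrite /gain_slope -mulrA; congr (_ * _).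
have s1 : s `^ 1 = s by rewrite powRr1// ltW.
by rewrite -{2}s1 -powRD ?subrK// (gt_eqF s0) implybT.
Qed.

(** The vector [x] is an eigenvector of the Jacobian of [phi1], with the bracket as eigenvalue, so
    this is the Jacobian applied to [phi1 x]. *)
Lemma phi2E (x : 'cV[R]_n) : x != 0 ->
  phi2 p k3 x =
  ((gain (dot x x) + gain_slope (dot x x) * dot x x) * gain (dot x x)) *: x.
Proof.
move=> x0; rewrite gain_slope_mul ?dot_gt0// /phi2 sqnorm2E -!scalerDl.
congr (_ *: _); rewrite /gain.
have -> : 2 * (1 - p) / (3 * p - 2) = a + a by rewrite /a; ring.
have s0 := dot_gt0 x0; rewrite -/a powRD ?(gt_eqF s0) ?implybT//.
set A := _ `^ a; rewrite /a; field; move: hp1; lra.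
Qed.

Lemma lyapE (e : E) :
  lyap e = P0 * dot (phi1 p k3 e.1) (phi1 p k3 e.1) +
    2 * P01 * dot (phi1 p k3 e.1) e.2 + P1 * dot e.2 e.2.
Proof. by rewrite phi1E !dotZl !dotZr /lyap; ring. Qed.

(** For the upper bound, trace times squared norm minus [V] is the form of the adjugate matrix,
    which is again positive definite. *)
Lemma quadratic_bounds (u v : 'cV[R]_n) :
  let V := P0 * dot u u + 2 * P01 * dot u v + P1 * dot v v in
  (P0 * P1 - P01 ^+ 2) / (P0 + P1) * (dot u u + dot v v) <= V <=
  (P0 + P1) * (dot u u + dot v v).
Proof.
have r0 : 0 <= 1 + 0 * dot (0 : 'cV[R]_n) 0 by rewrite mul0r addr0.
have := wdot_posdef_ge (lexx 0) r0 u v P00 P10 detP.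
rewrite /wdot !mul1r !mul0r !addr0 => H1; apply/andP; split=> //.
have det' : 0 < P1 * P0 - (- P01) ^+ 2 by rewrite sqrrN mulrC.
have := wdot_posdef_ge (lexx 0) r0 u v P10 P00 det'.
rewrite /wdot !mul1r !mul0r !addr0 => H2.
have : 0 <= (P1 * P0 - (- P01) ^+ 2) / (P1 + P0) * (dot u u + dot v v).
  apply: mulr_ge0; last by rewrite addr_ge0 ?dot_ge0.
  by apply/ltW/divr_gt0 => //; exact: addr_gt0.
move: H2; lra.
Qed.

(** V controls [phi1 e1] and [e2], and [phi1 e1] is at least [k3] times as long as [e1]. *)
Lemma lyap_sublevel_bounded c : bounded_set [set e : E | lyap e <= c].
Proof.
pose d := (P0 * P1 - P01 ^+ 2) / (P0 + P1).
have d0 : 0 < d by rewrite divr_gt0// addr_gt0.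
exists (Num.max (Num.sqrt (c / d / k3 ^+ 2)) (Num.sqrt (c / d))); split.
  by rewrite num_real.
move=> M hM e /=; rewrite lyapE => ec.
have /andP[H _] := quadratic_bounds (phi1 p k3 e.1) e.2.
have {}H : dot (phi1 p k3 e.1) (phi1 p k3 e.1) + dot e.2 e.2 <= c / d.
  by rewrite ler_pdivlMr// mulrC; exact: le_trans H ec.
apply: le_trans (ltW hM); rewrite [leLHS]/Num.Def.normr/= ge_max !le_max.
apply/andP; split; apply/orP; [left|right];
  apply: le_trans (norm_le_sqrt_dot _) _; apply: ler_wsqrtr; last first.
  by apply: le_trans H; rewrite lerDr dot_ge0.
rewrite ler_pdivlMr ?exprn_gt0//; apply: le_trans H.
rewrite phi1E dotZl dotZr mulrA -expr2 mulrC ler_wpDr ?dot_ge0//.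
by rewrite ler_wpM2r ?dot_ge0// ler_sqr ?nnegrE ?gain_ge// ltW// gain_gt0.
Qed.

Lemma phi1_continuous : continuous (@phi1 R n p k3).
Proof.
have /andP[a4 a0] := gain_exponent_bounds.
move=> x; have -> : @phi1 R n p k3 = fun y => k3 *: y + dot y y `^ a *: y.
  by apply/funext => y; rewrite /phi1 sqnorm2E.
have a2 : - 2^-1 < a by lra.
have c1 : k3 *: y @[y --> x] --> k3 *: x by exact: cvgZ (cvg_cst _) cvg_id.
exact: cvgD c1 (powR_dot_scale_continuous a2 (x := x)).
Qed.

Lemma lyap_continuous : continuous lyap.
Proof.
move=> e; have -> : lyap = fun e : E =>
    P0 * dot (phi1 p k3 e.1) (phi1 p k3 e.1) +
    2 * P01 * dot (phi1 p k3 e.1) e.2 + P1 * dot e.2 e.2.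
  by apply/funext => ?; rewrite lyapE.
have c2 : {for e, continuous (@snd 'cV[R]_n 'cV[R]_n)} by exact: cvg_snd.
have c1 : {for e, continuous (fun e : E => phi1 p k3 e.1)}.
  apply: (@continuous_comp _ _ _ fst); first exact: cvg_fst.
  exact: phi1_continuous.
have H (f h : E -> 'cV[R]_n) k :
    {for e, continuous f} -> {for e, continuous h} ->
    k * dot (f e) (h e) @[e --> e] --> k * dot (f e) (h e).
  move=> cf ch; apply: cvgM; first exact: cvg_cst.
  exact: dot_continuous.
by apply: cvgD; [apply: cvgD|]; exact: H.
Qed.

Lemma lyap_is_derive (x : R -> E) (t : R) (d : E) :
  (x t).1 != 0 -> is_derive t 1 x d ->
  let s := dot (x t).1 (x t).1 in
  let g := gain s in
  let b := gain_slope s in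
  is_derive t 1 (lyap \o x)
  (P0 * (2 * g * (b * dot (x t).1 d.1) * s + g ^+ 2 * (2 * dot (x t).1 d.1)) +
   2 * P01 * (b * dot (x t).1 d.1 * dot (x t).1 (x t).2 +
              g * (dot d.1 (x t).2 + dot (x t).1 d.2)) +
   P1 * (2 * dot (x t).2 d.2)).
Proof.
move=> xt0 xd s g b.
have s0 : 0 < s := dot_gt0 xt0.
have d1 : is_derive t 1 (fun t => (x t).1) d.1.
  apply: (@is_derive_linear _ _ _ (@fst 'cV[R]_n 'cV[R]_n)) xd => //.
  by move=> ?; exact: cvg_fst.
have d2 : is_derive t 1 (fun t => (x t).2) d.2.
  apply: (@is_derive_linear _ _ _ (@snd 'cV[R]_n 'cV[R]_n)) xd => //.
  by move=> ?; exact: cvg_snd.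
have dM (f h : R -> R) df dh : is_derive t 1 f df -> is_derive t 1 h dh ->
    is_derive t 1 (fun t => f t * h t) (f t * dh + h t * df).
  by move=> ? ?; exact: is_deriveM.
have dD (f h : R -> R) df dh : is_derive t 1 f df -> is_derive t 1 h dh ->
    is_derive t 1 (fun t => f t + h t) (df + dh).
  by move=> ? ?; exact: is_deriveD.
have dC (k : R) : is_derive t 1 (fun=> k) (0 : R) by exact: is_derive_cst.
have ds := is_derive_dot d1 d1.
have dw := is_derive_dot d1 d2.
have dq := is_derive_dot d2 d2.
have dg : is_derive t 1 (fun t => gain (dot (x t).1 (x t).1))
    (b * dot (x t).1 d.1).
  have dpow : is_derive (dot (x t).1 (x t).1) 1
      (@powR R ^~ a) (a * s `^ (a - 1)).
    exact: is_derive1_powR.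
  have dc := is_derive1_comp dpow ds.
  apply: (is_derive_eq (dD _ _ _ _ (dC k3) dc)).
  by rewrite /b /gain_slope -/s (dotC d.1); ring.
have dP0 := dM _ _ _ _ (dC P0) (dM _ _ _ _ (dM _ _ _ _ dg dg) ds).
have dP01 := dM _ _ _ _ (dC (2 * P01)) (dM _ _ _ _ dg dw).
have dP1 := dM _ _ _ _ (dC P1) dq.
apply: (is_derive_eq (dD _ _ _ _ (dD _ _ _ _ dP0 dP01) dP1)).
rewrite -/s -/g (dotC d.1 (x t).1) (dotC d.2); ring.
Qed.

Lemma bounded_perturbation_dot (d : R -> E) t : bounded_perturbation dbar d ->
  dot (d t).1 (d t).1 <= dbar ^+ 2 /\ dot (d t).2 (d t).2 <= dbar ^+ 2.
Proof.
move=> /(_ t); rewrite /norm2 => dB.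
have dbar0 : 0 <= dbar by exact: le_trans (sqrtr_ge0 _) dB.
have : sqnorm2 (col_mx (d t).1 (d t).2) <= dbar ^+ 2.
  have s0 : 0 <= sqnorm2 (col_mx (d t).1 (d t).2) by rewrite sqnorm2E dot_ge0.
  by rewrite -[leLHS]sqr_sqrtr// ler_sqr ?nnegrE ?sqrtr_ge0.
rewrite /sqnorm2 tr_col_mx mul_row_col mxE -!/(sqnorm2 _) !sqnorm2E => H.
by split; apply: le_trans H; rewrite ?lerDl ?lerDr dot_ge0.
Qed.

Lemma lyap_rate (d : R -> E) (x : R -> E) (t : R) :
  bounded_perturbation dbar d ->
  is_derive t 1 x (perturbed_system p k1 k2 k3 d t (x t)) ->
  (x t).1 != 0 -> lyap_level < lyap (x t) ->
  exists2 l, is_derive t 1 (lyap \o x) l & l <= - k3.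
Proof.
move=> dB xd x0 Vc; have := lyap_is_derive x0 xd => /= H.
eexists; first exact: H.
have s0 := dot_gt0 x0.
have /andP[a4 a0] := gain_exponent_bounds.
have [d1D d2D] := bounded_perturbation_dot t dB.
have A0 := powR_ge0 (dot (x t).1 (x t).1) a.
apply: (lyapunov_rate Q00 Q10 detQ hk3 (sqr_ge0 dbar) (gain_ge _) _ _ d1D d2D).
- by rewrite /gain_slope mulr_le0_ge0 ?powR_ge0// pmulr_rle0 ?ltW.
(* The claim [g / 2 <= r] reads [0 <= k3 / 2 + (2 * a + 1/2) * s^a], which follows from
   [a > -1/4]. *)
- rewrite gain_slope_mul// /gain.
  have := mulr_ge0 (_ : 0 <= 2 * a + 2^-1) A0; rewrite mulrDl => H1.
  have := H1 ltac:(lra); move: hk3; lra.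
- have := quadratic_bounds (phi1 p k3 (x t).1) (x t).2.
  rewrite /= -lyapE => /andP[_ H1].
  have := lt_le_trans Vc H1; rewrite /lyap_level ltr_pM2l ?addr_gt0// => /ltW.
  by rewrite phi1E dotZl dotZr mulrA -expr2.
- by rewrite /= phi1E.
- by rewrite /= phi2E.
Qed.

(** * Decrease of V along one trajectory *)

Section Trajectory.
Variables (t0 b : R) (d : R -> E) (y : R -> E).
Hypotheses (dB : bounded_perturbation dbar d) (cy : continuous y).
Hypothesis ACy : abs_continuous_on t0 b y.
Hypothesis dy : {ae (@lebesgue_measure R), forall t : R, t0 < t -> t < b ->
  is_derive t (1 : R) y (perturbed_system p k1 k2 k3 d t (y t))}.

Local Notation V t := (lyap (y t)).

Lemma lyap_traj_continuous : continuous (lyap \o y).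
Proof.
move=> t; apply: continuous_comp; first exact: cy.
exact: lyap_continuous.
Qed.

(** With [e1] bounded away from 0 the power in [gain] is Lipschitz; the rest is polynomial on a
    bounded set. *)
Lemma lyap_lipschitz_on (B m : R) : 0 < m ->
  lipschitz_on [set e : E | `|e| <= B /\ m <= dot e.1 e.1] lyap.
Proof.
move=> m0; set K := [set e : E | _].
have bK : exists B : R, forall e, K e -> `|e| <= B by exists B => e [].
have /andP[_ a0] := gain_exponent_bounds.
have l1 i : lipschitz_on K (fun e : E => e.1 i 0).
  exists 1 => u v _ _; rewrite mul1r.
  rewrite -[X in `|X|](_ : (u - v).1 i 0 = _); last by rewrite !mxE.
  rewrite (le_trans (norm_coord_le _ i))//.
  by rewrite [leRHS]/Num.Def.normr/= le_max lexx.
have l2 i : lipschitz_on K (fun e : E => e.2 i 0).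
  exists 1 => u v _ _; rewrite mul1r.
  rewrite -[X in `|X|](_ : (u - v).2 i 0 = _); last by rewrite !mxE.
  rewrite (le_trans (norm_coord_le _ i))//.
  by rewrite [leRHS]/Num.Def.normr/= le_max lexx orbT.
have ls : lipschitz_on K (fun e : E => dot e.1 e.1).
  by apply: lipschitz_on_sum => i; exact: lipschitz_onM.
have lw : lipschitz_on K (fun e : E => dot e.1 e.2).
  by apply: lipschitz_on_sum => i; exact: lipschitz_onM.
have lq : lipschitz_on K (fun e : E => dot e.2 e.2).
  by apply: lipschitz_on_sum => i; exact: lipschitz_onM.
have lg : lipschitz_on K (fun e : E => gain (dot e.1 e.1)).
  apply: lipschitz_onD; first exact: lipschitz_on_cst.
  by apply: (@lipschitz_on_powR _ _ _ m) => //; [exact: ltW|move=> u []].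
have lC k : lipschitz_on K (fun=> k) := lipschitz_on_cst K k.
apply: lipschitz_onD; first apply: lipschitz_onD.
- by do 3?[apply: lipschitz_onM => //].
- by do 2?[apply: lipschitz_onM => //].
- by apply: lipschitz_onM.
Qed.

(** By compactness [y] is bounded and [e1] stays away from 0, so V is Lipschitz along [y], hence
    absolutely continuous there. *)
Lemma lyap_decr_closed s t : t0 <= s -> s <= t -> t <= b ->
  (forall r, s <= r -> r <= t -> (y r).1 != 0 /\ lyap_level < V r) ->
  V t - V s <= - k3 * (t - s).
Proof.
move=> t0s st tb H.
have cn : continuous (fun r => `|y r|).
  by move=> r; apply: continuous_comp; [exact: cy|exact: norm_continuous].
have cs : continuous (fun r => dot (y r).1 (y r).1).
  have c1 : continuous (fun r => (y r).1).
    have cf : continuous (@fst 'cV[R]_n 'cV[R]_n) by move=> ?; exact: cvg_fst.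
    by move=> r; exact: continuous_comp (@cy r) (cf (y r)).
  by move=> r; exact: (dot_continuous (c1 r) (c1 r)).
have [rB _ HB] := EVT_max st (continuous_subspaceT cn).
have [rm rm_st Hm] := EVT_min st (continuous_subspaceT cs).
have m0 : 0 < dot (y rm).1 (y rm).1.
  move: rm_st; rewrite in_itv/= => /andP[srm rmt]; apply: dot_gt0.
  by case: (H rm srm rmt).
have [M hM] := lyap_lipschitz_on `|y rB| m0.
apply: (@le_of_derive_ae_le _ (lyap \o y)) => //.
  apply: (abs_continuous_on_dominated (M := M)).
    exact: abs_continuous_on_sub ACy.
  move=> u v su uv vt; apply: hM; split.
  - by apply: HB; rewrite in_itv/= vt (le_trans su).
  - by apply: Hm; rewrite in_itv/= vt (le_trans su).
  - by apply: HB; rewrite in_itv/= su (le_trans uv).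
  - by apply: Hm; rewrite in_itv/= su (le_trans uv).
apply: negligibleS dy => r; apply: contra_not => dyr sr rt.
have [y0 Vr] := H r (ltW sr) (ltW rt).
apply: (lyap_rate dB) => //; apply: dyr.
  exact: le_lt_trans sr.
exact: lt_le_trans tb.
Qed.

Lemma lyap_decr_open s t : t0 <= s -> s <= t -> t <= b ->
  (forall r, s < r -> r < t -> (y r).1 != 0 /\ lyap_level < V r) ->
  V t - V s <= - k3 * (t - s).
Proof.
move=> t0s st tb H.
suff : V t + k3 * t <= V s + k3 * s by lra.
apply: (@le_of_open_le _ (fun r => V r + k3 * r)) st _ => [r|u v su uv vt].
  apply: cvgD; first exact: lyap_traj_continuous.
  by apply: cvgM; [exact: cvg_cst|exact: cvg_id].
suff : V v - V u <= - k3 * (v - u) by lra.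
apply: lyap_decr_closed => //; [lra|lra|move=> r ur rv].
by apply: H; lra.
Qed.

(** With [w] the value of [e2] at the zero, [w.e1] has derivative close to [w.(w + delta1)], at
    least half of [|w|^2 - dbar^2], hence positive. *)
Lemma first_coord_isolated_zero r : t0 <= r -> r <= b -> (y r).1 = 0 ->
  lyap_level < V r ->
  exists2 eta : R, 0 < eta &
    forall t, t0 <= t -> t <= b -> t != r -> `|t - r| < eta -> (y t).1 != 0.
Proof.
move=> t0r rb y0 Vr; set w := (y r).2.
have qD : dbar ^+ 2 < dot w w.
  have thr := threshold_gt k3 Q00 Q10 detQ (sqr_ge0 dbar).
  move: Vr; rewrite /lyap_level /lyap y0 -/w !(dotC 0) !dot0r !mulr0 !add0r => Vr.
  rewrite -(ltr_pM2l P10); apply: lt_trans Vr; move: thr.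
  set T := threshold _ _ _ _ _ _ _ => thr.
  have T0 : 0 <= T by apply: le_trans (ltW thr); rewrite sqr_ge0.
  by rewrite mulrDl ltr_wpDl ?ltr_pM2l// mulr_ge0// ltW.
(* AM-GM on [w.delta1] leaves [2 * k]; the variation of [m] near [r] costs one [k]. *)
pose k := (dot w w - dbar ^+ 2) / 4.
have k0 : 0 < k by rewrite divr_gt0// subr_gt0.
(* The perturbation-free part of the derivative of [w.e1]: it is continuous in [t], which the
   perturbation need not be. *)
pose m t := dot w (- (k1 *: phi1 p k3 (y t).1) + (y t).2).
have cf : continuous (@fst 'cV[R]_n 'cV[R]_n) by move=> ?; exact: cvg_fst.
have cs : continuous (@snd 'cV[R]_n 'cV[R]_n) by move=> ?; exact: cvg_snd.
have cm : {for r, continuous m}.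
  have c1 : {for r, continuous (fun t => phi1 p k3 (y t).1)}.
    have cy1 := continuous_comp (@cy r) (cf (y r)).
    exact: continuous_comp cy1 (@phi1_continuous (y r).1).
  have c2 : {for r, continuous (fun t => (y t).2)}.
    exact: continuous_comp (@cy r) (cs (y r)).
  apply: dot_continuous; first exact: cvg_cst.
  exact: cvgD (cvgN (cvgZ (cvg_cst k1) c1)) c2.
have mr : m r = dot w w.
  by rewrite /m y0 phi1E !scaler0 oppr0 add0r.
have [eta /= eta0 Heta] := (@cvgrPdist_lt _ _ _ _ (nbhs_filter r) _ _).1
  cm k k0.
exists eta => // t t0t tb tr treta.
have mgt u : `|u - r| < eta -> dot w w - k < m u.
  rewrite distrC => /Heta; rewrite mr ltr_norml => /andP[]; lra.
pose f u := dot (- w) (y u).1.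
have decr u v : t0 <= u -> u <= v -> v <= b ->
    (forall z, u <= z -> z <= v -> `|z - r| < eta) ->
    f v - f u <= - k * (v - u).
  move=> t0u uv vb uvr; apply: le_of_derive_ae_le => //.
    apply: (abs_continuous_on_dominated (M := \sum_i `|(- w) i 0|)).
      exact: abs_continuous_on_sub ACy.
    move=> z z' _ _ _; rewrite /f -[- dot (- w) _]dotNr -dotDr mulr_suml.
    apply: le_trans (ler_norm_sum _ _ _) _; apply: ler_sum => i _.
    rewrite normrM ler_wpM2l// (le_trans (norm_coord_le _ i))//.
    by rewrite [leRHS]/Num.Def.normr/= le_max lexx.
  apply: negligibleS dy => z; apply: contra_not => dyz uz zv.
  have {}dyz := dyz (le_lt_trans t0u uz) (lt_le_trans zv vb).
  set e := perturbed_system _ _ _ _ _ _ _ in dyz.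
  have d1 : is_derive z 1 (fun t => (y t).1) e.1.
    exact: (@is_derive_linear _ _ _ (@fst 'cV[R]_n 'cV[R]_n)) dyz.
  have dc : is_derive z 1 (fun=> - w) (0 : 'cV[R]_n) by exact: is_derive_cst.
  eexists; first exact: is_derive_dot dc d1.
  rewrite (dotC 0) dot0r add0r dotNl /= dotDr.
  have := mgt z (uvr z (ltW uz) (ltW zv)).
  have [D1 _] := bounded_perturbation_dot z dB.
  have := dot_ge0 (w + (d z).1).
  rewrite !(dotDl, dotDr) (dotC _ w) /m /k !dotDr => ? ?; lra.
have fr : f r = 0 by rewrite /f y0 dot0r.
(* A second zero would make [f] vanish at both ends of an interval on which it strictly
   decreases. *)
apply/eqP => yt0; have ft : f t = 0 by rewrite /f yt0 dot0r.
case: (ltgtP t r) tr => // tr _.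
  have := decr t r t0t (ltW tr) rb; rewrite fr ft subrr => H.
  suff : 0 <= - k * (r - t) by rewrite mulNr oppr_ge0 pmulr_rle0// subr_le0; lra.
  apply: H => z tz zr; rewrite distrC in treta; rewrite distrC.
  by apply: le_lt_trans treta; rewrite !ger0_norm ?subr_ge0 ?(ltW tr)//; lra.
have := decr r t t0r (ltW tr) tb; rewrite fr ft subrr => H.
suff : 0 <= - k * (t - r) by rewrite mulNr oppr_ge0 pmulr_rle0// subr_le0; lra.
apply: H => z tz zr.
by apply: le_lt_trans treta; rewrite !ger0_norm ?subr_ge0 ?(ltW tr)//; lra.
Qed.

(** The maximum with [c] makes the estimate transitive, hence fit for interval induction. As [c] is
    strictly above the level, V exceeds the level on a whole neighborhood of any point where it is
    at least [c]. *)
Lemma lyap_traj_le c s t : lyap_level < c -> t0 <= s -> s <= t -> t <= b ->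
  V t <= Num.max c (V s - k3 * (t - s)).
Proof.
move=> levc t0s st tb.
apply: (@interval_induction _
  (fun u v => V v <= Num.max c (V u - k3 * (v - u))) _ _ st).
  move=> x z z' sx xz zz' z't H1 H2; apply: le_trans H2 _.
  rewrite ge_max le_max lexx/=.
  have H3 : k3 * (z' - x) = k3 * (z - x) + k3 * (z' - z) by ring.
  have H4 : 0 <= k3 * (z' - z) by rewrite mulr_ge0 ?subr_ge0// ltW.
  move: H1; rewrite !le_max => /orP[H1|H1]; apply/orP; [left|right]; lra.
move=> r sr rt.
have near_r e (G : set R) : 0 < e -> (forall z, `|V r - V z| < e -> G z) ->
    exists2 eta : R, 0 < eta & forall z, r - eta < z -> z < r + eta -> G z.
  move=> e0 HG.
  have [eta /= eta0 Heta] := (@cvgrPdist_lt _ _ _ _ (nbhs_filter r) _ _).1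
    (@lyap_traj_continuous r) _ e0.
  exists eta => // z z1 z2; apply/HG/Heta => /=.
  by rewrite ltr_distlC z1 z2.
have [rc|cr] := ltP (V r) c.
  have [|z|eta eta0 Heta] := near_r (c - V r) (fun z => V z < c).
  - by rewrite subr_gt0.
  - by rewrite ltr_distlC => /andP[_]; rewrite subrKC.
  exists eta => // x z sx rx xr rz zr zt; rewrite le_max ltW//.
  by apply: Heta => //; apply: lt_le_trans rz; rewrite ltrBlDr ltrDl.
have levr : lyap_level < V r by exact: lt_le_trans cr.
have [|z|eta eta0 Heta] := near_r (V r - lyap_level)
  (fun z => lyap_level < V z).
- by rewrite subr_gt0.
- by rewrite ltr_distlC => /andP[]; rewrite subKr.
have t0r : t0 <= r by exact: le_trans sr.
have rb : r <= b by exact: le_trans tb.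
(* Whether or not [e1] vanishes at [r], it vanishes nowhere else nearby, so the decrease holds on
   each side of [r]. *)
have [eta' eta'0 Heta'] : exists2 eta : R, 0 < eta &
    forall z, t0 <= z -> z <= b -> z != r -> `|z - r| < eta -> (y z).1 != 0.
  have [y0|y0] := eqVneq (y r).1 0; first exact: first_coord_isolated_zero.
  have cf : continuous (@fst 'cV[R]_n 'cV[R]_n) by move=> ?; exact: cvg_fst.
  have cy1 := continuous_comp (@cy r) (cf (y r)).
  have cyy : {for r, continuous (fun z => dot (y z).1 (y z).1)}.
    exact: (dot_continuous cy1 cy1).
  have [eta' /= eta'0 H] := (@cvgrPdist_lt _ _ _ _ (nbhs_filter r) _ _).1
    cyy _ (dot_gt0 y0).
  exists eta' => // z _ _ _; rewrite distrC => /H; apply: contraTneq => ->.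
  by rewrite dot0r subr0 ger0_norm ?dot_ge0// ltxx.
exists (Num.min eta eta'); first by rewrite lt_min eta0.
move=> x z sx; rewrite !ltrBlDr -!ltrBlDl !lt_min.
move=> /andP[x1 x2] xr rz /andP[z1 z2] zt.
have H1 : V r - V x <= - k3 * (r - x).
  apply: lyap_decr_open => //; first exact: le_trans sx.
  move=> u xu ur; split; last by apply: Heta; lra.
  apply: Heta'; [lra|lra|by rewrite lt_eqF|].
  by rewrite ltr0_norm; lra.
have H2 : V z - V r <= - k3 * (z - r).
  apply: lyap_decr_open => //; first exact: le_trans tb.
  move=> u xu ur; split; last by apply: Heta; lra.
  apply: Heta'; [lra|lra|by rewrite gt_eqF|].
  by rewrite gtr0_norm; lra.
have H3 : k3 * (z - x) = k3 * (z - r) + k3 * (r - x) by ring.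
by rewrite le_max; apply/orP; right; lra.
Qed.

End Trajectory.
End LyapunovFunction.

(** * Practical stability *)

Section TwoByTwo.
Variable R : realType.

Lemma posdefmx2 (A : 'M[R]_2) : posdefmx A ->
  [/\ A 1 0 = A 0 1, 0 < A 0 0, 0 < A 1 1 & 0 < A 0 0 * A 1 1 - A 0 1 ^+ 2].
Proof.
move=> [symA posA].
have A10 : A 1 0 = A 0 1 by rewrite -[in LHS]symA mxE.
have quad a b : (a != 0) || (b != 0) ->
    0 < A 0 0 * a ^+ 2 + 2 * A 0 1 * a * b + A 1 1 * b ^+ 2.
  move=> ab; pose x : 'cV[R]_2 := \col_i (if i == 0 then a else b).
  have x0 : x != 0.
    apply: contraTneq ab => /matrixP E.
    by have := E 0 0; have := E 1 0; rewrite !mxE/= => -> ->; rewrite eqxx.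
  suff <- : (x^T *m A *m x) 0 0 = A 0 0 * a ^+ 2 + 2 * A 0 1 * a * b +
      A 1 1 * b ^+ 2 by exact: posA.
  have l1 : lift ord0 ord0 = 1 :> 'I_2 by exact/val_inj.
  rewrite mxE !big_ord_recl big_ord0 l1 !mxE !big_ord_recl !big_ord0 !l1 !mxE/=.
  by rewrite A10; ring.
have A00 : 0 < A 0 0.
  have := quad 1 0; rewrite oner_eq0 => /(_ isT).
  by rewrite expr1n expr0n/=; lra.
have A11 : 0 < A 1 1.
  have := quad 0 1; rewrite oner_eq0 orbT => /(_ isT).
  by rewrite expr1n expr0n/=; lra.
(* At this vector the form is [A 0 0] times the determinant. *)
split=> //; have := quad (- A 0 1) (A 0 0).
rewrite (gt_eqF A00) orbT => /(_ isT) H.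
rewrite -(pmulr_rgt0 _ A00); apply: lt_le_trans H _.
by rewrite le_eqVlt; apply/orP; left; apply/eqP; ring.
Qed.

Lemma AstarE (k1 k2 : R) :
  [/\ Astar k1 k2 0 0 = - k1, Astar k1 k2 0 1 = 1,
      Astar k1 k2 1 0 = - k2 & Astar k1 k2 1 1 = 0].
Proof.
have l0 : 0 = lshift 1 (0 : 'I_1) :> 'I_(1 + 1) by exact/val_inj.
have r1 : 1 = rshift 1 (0 : 'I_1) :> 'I_(1 + 1) by exact/val_inj.
rewrite /Astar r1 l0; split.
- by apply: (etrans (block_mxEul _ _ _ _ 0 0)); rewrite mxE mulr1n.
- by apply: (etrans (block_mxEur _ _ _ _ 0 0)); rewrite mxE mulr1n.
- by apply: (etrans (block_mxEdl _ _ _ _ 0 0)); rewrite mxE mulr1n.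
- by apply: (etrans (block_mxEdr _ _ _ _ 0 0)); rewrite mxE.
Qed.

Lemma lyapunov_equation2 (k1 k2 : R) (P Q : 'M[R]_2) : P 1 0 = P 0 1 ->
  (Astar k1 k2)^T *m P + P *m Astar k1 k2 = - Q ->
  [/\ Q 0 0 = Qform00 (P 0 0) (P 0 1) k1 k2,
      Q 0 1 = Qform01 (P 0 0) (P 0 1) (P 1 1) k1 k2 & Q 1 1 = Qform11 (P 0 1)].
Proof.
have [A00 A01 A10 A11] := AstarE k1 k2.
move: (Astar k1 k2) A00 A01 A10 A11 => A A00 A01 A10 A11 P10 /matrixP H.
have l1 : lift ord0 ord0 = 1 :> 'I_2 by exact/val_inj.
have := H 0 0; have := H 0 1; have := H 1 1.
rewrite !mxE !big_ord_recl !big_ord0 !mxE !l1 A00 A01 A10 A11 P10.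
by rewrite /Qform00 /Qform01 /Qform11 => H11 H01 H00; split; lra.
Qed.

End TwoByTwo.

Section SolutionLyapunov.
Variables (R : realType) (n : nat) (p k1 k2 k3 P0 P01 P1 dbar : R).
Local Notation E := ('cV[R]_n * 'cV[R]_n)%type.
Local Notation V := (@lyap R n p k3 P0 P01 P1).
Hypotheses (hp1 : 1 < p) (hp2 : p < 2) (hk3 : 0 < k3).
Hypotheses (P00 : 0 < P0) (P10 : 0 < P1) (detP : 0 < P0 * P1 - P01 ^+ 2).
Hypotheses (Q00 : 0 < Qform00 P0 P01 k1 k2) (Q10 : 0 < Qform11 P01).
Hypothesis detQ :
  0 < Qform00 P0 P01 k1 k2 * Qform11 P01 - Qform01 P0 P01 P1 k1 k2 ^+ 2.

(* The solution is only continuous on [t0, t1[, so it is extended by constants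
   outside of [t0, t]. *)
Lemma solution_lyap_le (d : R -> E) (t0 : R) (t1 : \bar R) (x : R -> E)
    (c s t : R) :
  bounded_perturbation dbar d ->
  is_solution (perturbed_system p k1 k2 k3 d) t0 t1 x ->
  lyap_level k1 k2 k3 P0 P01 P1 dbar < c ->
  t0 <= s -> s <= t -> (t%:E < t1)%E ->
  V (x t) <= Num.max c (V (x s) - k3 * (t - s)).
Proof.
move=> dB [ACx dx] levc t0s st tt1.
have t0t : t0 <= t by exact: le_trans st.
have ACt := ACx t t0t tt1.
pose y r := x (Num.max t0 (Num.min t r)).
have yx r : t0 <= r -> r <= t -> y r = x r.
  by move=> t0r rt; rewrite /y (min_idPr rt) (max_idPr t0r).
have cy : continuous y := abs_continuous_on_cst_outside t0t ACt.
have ACy : abs_continuous_on t0 t y.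
  apply: (abs_continuous_on_dominated (M := 1) ACt) => u v t0u uv vt.
  by rewrite mul1r !yx// ?(le_trans t0u)// (le_trans uv).
have dy : {ae (@lebesgue_measure R), forall r : R, t0 < r -> r < t ->
    is_derive r (1 : R) y (perturbed_system p k1 k2 k3 d r (y r))}.
  apply: negligibleS dx => r; apply: contra_not => dxr t0r rt.
  rewrite yx ?(ltW t0r) ?(ltW rt)//.
  apply: (near_eq_is_derive (f := x)); last first.
    by apply: dxr; [exact: ltW|apply: lt_trans tt1; rewrite lte_fin].
  have rt0t : r \in `]t0, t[ by rewrite in_itv/= t0r rt.
  apply: filterS (near_in_itvoo rt0t) => z.
  by rewrite in_itv/= => /andP[t0z zt]; rewrite yx ?ltW.
have H := lyap_traj_le hp1 hp2 hk3 P00 P10 detP Q00 Q10 detQ dB cy ACy dy levc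
  t0s st (lexx t).
by rewrite -!yx// (le_trans t0s).
Qed.

Lemma lyapunov_stable :
  practically_finite_time_stable (bounded_perturbation dbar)
    (@perturbed_system R n p k1 k2 k3).
Proof.
(* Positivity of [c] makes the sublevel set a neighborhood of 0, where V vanishes; adding 1 puts [c]
   strictly above the level. *)
pose c := Num.max 0 (lyap_level k1 k2 k3 P0 P01 P1 dbar) + 1.
have c0 : 0 < c by rewrite ltr_wpDl// le_max lexx.
have levc : lyap_level k1 k2 k3 P0 P01 P1 dbar < c.
  apply: (@le_lt_trans _ _ (c - 1)); last by rewrite gtrBl.
  by rewrite /c addrK le_max lexx orbT.
have Vbnd c' := lyap_sublevel_bounded n p hk3 P00 P10 detP c'.
exists [set e : E | V e <= c]; split; [|exact: Vbnd|].
  have near0 := (@cvgrPdist_lt _ _ _ _ (nbhs_filter (0 : E)) _ _).1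
    (@lyap_continuous _ n _ k3 P0 P01 P1 hp1 hp2 0) c c0.
  apply: filterS near0 => e.
  rewrite /lyap !dot0r !mulr0 !addr0 sub0r normrN => /ltW.
  exact: le_trans (ler_norm _).
move=> d t0 t1 x dB t01 xsol.
have Vle s t := @solution_lyap_le d t0 t1 x c s t dB xsol levc.
split.
- move=> s t t0s st tt1 /= sc; apply: le_trans (Vle s t t0s st tt1) _.
  rewrite ge_max lexx/= lerBlDr (le_trans sc)// lerDl mulr_ge0 ?subr_ge0//.
  exact: ltW.
(* The time V needs to fall to [c] at rate [k3]. *)
- move=> t1E; pose T := t0 + Num.max 0 ((V (x t0) - c) / k3).
  have t0T : t0 <= T by rewrite lerDl le_max lexx.
  exists T => //=; apply: le_trans (Vle t0 T (lexx _) t0T _) _.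
    by rewrite t1E ltry.
  have TE : T - t0 = Num.max 0 ((V (x t0) - c) / k3) by rewrite /T addrC addKr.
  rewrite ge_max lexx/= TE lerBlDr -lerBlDl.
  by rewrite mulrC -ler_pdivrMr// le_max lexx orbT.
(* The solution never leaves the sublevel set of the larger of [c] and the initial value of V. *)
- move=> _; have [M [Mr HM]] := Vbnd (Num.max c (V (x t0))).
  exists M; split=> // M' MM' e [t [t0t tt1] <-]; apply: (HM M' MM') => /=.
  apply: le_trans (Vle t0 t (lexx _) t0t tt1) _.
  rewrite ge_max le_max lexx/= le_max; apply/orP; right.
  by rewrite lerBlDr lerDl mulr_ge0 ?subr_ge0// ltW.
Qed.

End SolutionLyapunov.

Theorem corollary1 (R : realType) (n : nat) (hn : (1 <= n)%N)
  (p k1 k2 k3 : R) (hp1 : 1 < p) (hp2 : p < 2)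
  (hk1 : 0 < k1) (hk2 : 0 < k2) (hk3 : 0 < k3)
  (hA : hurwitz (Astar k1 k2))
  (Qstar : 'M[R]_2) (hQ : posdefmx Qstar)
  (Pstar : 'M[R]_2) (hP : posdefmx Pstar)
  (hLyap : (Astar k1 k2)^T *m Pstar + Pstar *m Astar k1 k2 = - Qstar)
  (dbar : R) :
  let P : 'M[R]_(2 * n) := Pstar *t 1%:M in
  let Q : 'M[R]_(2 * n) := Qstar *t 1%:M in
  gamma1 k3 P Q >= lambda_max P / lambda_min P ->
  practically_finite_time_stable (bounded_perturbation dbar)
    (@perturbed_system R n p k1 k2 k3).
Proof.
move=> P Q _.
have [P10 P00 P11 detP] := posdefmx2 hP.
have [_ Q00 Q11 detQ] := posdefmx2 hQ.
have [Q00E Q01E Q11E] := lyapunov_equation2 P10 hLyap.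
rewrite Q00E in Q00 detQ; rewrite Q11E in Q11 detQ; rewrite Q01E in detQ.
exact: (lyapunov_stable n dbar hp1 hp2 hk3 P00 P11 detP Q00 Q11 detQ).
Qed.
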